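(* Let $d\ge 1$ and $\partial\ge 0$ be integers, with $d\ge 3$ if $\partial=0$, and set $N=2d+4\partial-4$. Let $w\in Rat^\star_{d+\partial,\partial}$ and let $g(z)=\frac{\alpha z+\beta}{\gamma z+\delta}$, $\alpha\delta-\beta\gamma\neq0$, be a Möbius transformation such that $g\cdot w\in Rat^\star_{d+\partial,\partial}$. Then, up to a nonzero constant factor, $$ID_{d,\partial}(g\cdot w)=g\cdot ID_{d,\partial}(w).$$ Equivalently, the rational isodynamic divisors satisfy $\mathcal{I}_{g\cdot w}=g(\mathcal{I}_w)$ as divisors of degree $N$ on $\mathbb{C}P^1$. That is, the action of the Möbius group $\mathcal{M}\simeq PGL_2(\mathbb{C})$ on $Rat^\star_{d+\partial,\partial}$ and $\mathcal{P}_N$ commutes with the operation of taking the divisor of isodynamic points, i.e. with the map $ID_{d,\partial}$.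
   Context: $\mathcal{P}_N$ is the space of complex univariate polynomials of degree at most $N$. For $\partial\ge1$, $Rat^\star_{d+\partial,\partial}$ is the space of rational functions $w=\frac{p}{q}$ with $p,q$ coprime complex polynomials, $\deg p=d+\partial$, $\deg q=\partial$, both having only roots of multiplicity at most $2$. For $\partial=0$, $q\equiv1$ and $w=p$ is a polynomial of degree $d$ with roots of multiplicity at most $2$. All functions are considered up to a nonzero constant factor. Rational isodynamic map: for $w=p/q$ put $$N\mathcal{D}(z,u)=d\,p(z)q(z)+(u-z)\bigl(p'(z)q(z)-p(z)q'(z)\bigr),$$ the numerator of the polar derivative $d\,w(z)+(u-z)w'(z)$. As a polynomial in $z$ it has degree $d+2\partial-1$ (for all but one value of $u$). Then $$ID_{d,\partial}(w)(u)=\mathrm{Discr}(N\mathcal{D}(z,u),z)\in\mathcal{P}_N$$ is its discriminant with respect to $z$, as a polynomial of degree $d+2\partial-1$ in $z$ with coefficients in $\mathbb{C}[u]$. The rational isodynamic divisor $\mathcal{I}_w$ is the zero divisor of $ID_{d,\partial}(w)$, regarded as a divisor of degree $N$ on $\mathbb{C}P^1$ by counting $\infty$ with multiplicity $N-\deg ID_{d,\partial}(w)$. Action of Möbius transformations: $w$ is viewed as (the restriction to the chart $y=1$ of) the ratio $W(x,y)=P(x,y)/Q(x,y)$ of binary forms of degrees $d+\partial$ and $\partial$, where $P(x,y)=y^{d+\partial}p(x/y)$ and $Q(x,y)=y^\partial q(x/y)$, on which linear changes of variables act. Explicitly, with $g^{-1}(z)=\frac{\delta z-\beta}{-\gamma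 z+\alpha}$, $$(g\cdot w)(z)=(-\gamma z+\alpha)^d\,w(g^{-1}(z)),$$ so the zeros and poles of $w$ are moved by $g$. The condition $g\cdot w\in Rat^\star_{d+\partial,\partial}$ means that no zero or pole of $w$ in $\mathbb{C}$ is sent to $\infty$ by $g$. On $f\in\mathcal{P}_N$ the action is $(g\cdot f)(u)=(-\gamma u+\alpha)^N f(g^{-1}(u))$, which moves the zero divisor of $f$ (counted in $\mathbb{C}P^1$ as a divisor of degree $N$) by $g$. *)

(* Defs.v *)
From HB Require Import structures.
From mathcomp Require Import all_boot all_order all_algebra.
From mathcomp Require Import reals complex.
From mathcomp Require Import freeg.

Set Implicit Arguments.
Unset Strict Implicit.
Unset Printing Implicit Defensive.

Import GRing.Theory.

Local Open Scope ring_scope.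

Section Isodynamic.
Variable F : fieldType.
Implicit Types (p q f : {poly F}) (w : {poly F} * {poly F}) (d k n : nat).

(* A rational function p / q is represented by the pair (p, q).  For k = 0 the
   denominator is a nonzero constant, i.e. 1 up to a constant factor. *)
Definition RatStar d k w : Prop :=
  [/\ size w.1 = (d + k).+1, size w.2 = k.+1, coprimep w.1 w.2
    & forall x : F, (mup x w.1 <= 2)%N /\ (mup x w.2 <= 2)%N].

(* The outer variable of {poly {poly F}} is z, the inner one is u. *)
Definition polar_num d w : {poly {poly F}} :=
  (w.1 * w.2)^:P *+ d
  + (('X : {poly F})%:P - 'X) * (w.1^`() * w.2 - w.1 * w.2^`())^:P.

(* Res(h, h') is divisible by the leading coefficient of h, so the Euclidean
   quotient in F[u] is exact. *)
Definition discriminant (h : {poly {poly F}}) : {poly F} :=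
  (-1) ^+ 'C((size h).-1, 2) * (resultant h h^`() %/ lead_coef h).

Definition isodynamic d w : {poly F} := discriminant (polar_num d w).

(* For deg f <= n, the dehomogenization at y = 1 of
   y^n f(x/y) at (x, y) := (de x - be y, - ga x + al y). *)
Definition form_act (al be ga de : F) n f : {poly F} :=
  \sum_(i < n.+1)
    f`_i *: ((de *: 'X - be%:P) ^+ i * (al%:P - ga *: 'X) ^+ (n - i)).

Lemma form_actE (al be ga de : F) n f (z : F) :
  (size f <= n.+1)%N -> - ga * z + al != 0 ->
  (form_act al be ga de n f).[z] =
  (- ga * z + al) ^+ n * f.[(de * z - be) / (- ga * z + al)].
Proof.
move=> sz_f nz; rewrite (horner_coef_wide _ sz_f) /form_act horner_sum mulr_sumr.
apply: eq_bigr => i _; rewrite !hornerE mulNr [al - _]addrC.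
rewrite mulNr in nz; set t := - (ga * z) + al in nz *.
have -> : t ^+ n = t ^+ i * t ^+ (n - i) by rewrite -exprD subnKC // -ltnS.
rewrite expr_div_n; have nzi : t ^+ i != 0 by rewrite expf_neq0.
rewrite /= -[_ * _ * f`_i]mulrA [_ / t ^+ i]mulrC mulrACA divff // mul1r.
by rewrite [LHS]mulrC mulrA.
Qed.

Definition rat_act (al be ga de : F) d k w : {poly F} * {poly F} :=
  (form_act al be ga de (d + k) w.1, form_act al be ga de k w.2).

Lemma rat_actE (al be ga de : F) d k w (z : F) :
  (size w.1 <= (d + k).+1)%N -> (size w.2 <= k.+1)%N -> - ga * z + al != 0 ->
  let gw := rat_act al be ga de d k w in
  let z' := (de * z - be) / (- ga * z + al) in
  gw.1.[z] / gw.2.[z] = (- ga * z + al) ^+ d * (w.1.[z'] / w.2.[z']).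
Proof.
move=> s1 s2 nz /=; rewrite !form_actE // exprD invfM -!mulrA; congr (_ * _).
rewrite mulrCA; congr (_ * _).
by rewrite mulrA divff ?mul1r // expf_neq0.
Qed.

(* The projective line is option F, with None the point at infinity. *)
Definition mobius (al be ga de : F) (x : option F) : option F :=
  match x with
  | Some z => if ga * z + de == 0 then None
              else Some ((al * z + be) / (ga * z + de))
  | None => if ga == 0 then None else Some (al / ga)
  end.

End Isodynamic.

Section Divisors.
Variable F : closedFieldType.

(* The roots are listed with multiplicity.  Meaningful for f <> 0 of degree at
   most n; then the coefficient at infinity is n - deg f >= 0. *)
Definition zero_divisor (n : nat) (f : {poly F}) : {freeg (option F)} :=
  \sum_(x <- sval (closed_field_poly_normal f)) << Some x >>
  + << n%:Z - (size f).-1%:Z *g None >>.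

Definition push_divisor (g : option F -> option F) (D : {freeg (option F)}) :
  {freeg (option F)} := fglift (fun x => << g x >>) D.

End Divisors.

(* Main.v *)
Require Import Defs.
From mathcomp Require Import all_boot all_order all_algebra.
From mathcomp Require Import reals complex.
From mathcomp Require Import freeg.
From mathcomp Require Import ring zify.
From HB Require Import structures.

(** Why the isodynamic map commutes with Mobius transformations.

    Put n = d + 2k - 1 and write P, Q for the homogenizations of p, q, of
    degrees d + k and k.  The numerator of the polar derivative is the chart
    y = t = 1 of the form
      H(x, y; s, t) = (s P_x + t P_y) Q - P (s Q_x + t Q_y),
    of degree n in (x, y) and 1 in (s, t).  It is a directional derivative, so
    by the chain rule a linear change of variables M in P / Q turns H(v; v')
    into H(M v; M v').  Read in the chart, this is [polar_rat_act]: the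
    transformed numerator at u is (- ga u + al) times the transform, as a form
    of degree n, of the original numerator at g^-1(u).

    The discriminant of a form of degree n is homogeneous of degree
    2n - 2 = N in its coefficients ([form_discrZ]) and is multiplied by a
    nonzero constant under a linear substitution ([form_discr_act]).  Taking
    discriminants therefore gives, for all u other than the pole of g^-1, a
    constant times (- ga u + al)^N ID_w (g^-1(u)), which is the action on
    polynomials of degree at most N ([form_discr_polar_act]).

    To commute with evaluation at every u, even where the degree in z drops,
    the discriminant is taken as the resultant of the two partial derivatives
    of the form, a determinant of fixed size 2n - 2.  A substitution multiplies that Sylvester matrix on both
    sides by invertible matrices of scalars: substitution matrices
    ([form_resultant_act]) and the 2 x 2 chain rule ([form_resultant_lin]).
    Euler's relation n F = x F_x + y F_y and row operations compare this
    determinant with the quotient of Res(h, h') by the leading coefficient of h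
    ([resultant_deriv], [discriminant_form]).

    For ID_w <> 0 one value of u with a separable numerator is enough
    ([form_discr_polar_neq0]).  The numerator is a pencil A + u B, and since p
    and q are coprime with roots of multiplicity at most 2, A and B have no
    common double root ([polar_no_common_double_root]).  In a pencil without a
    common double root, a double root of a member is a root of the Wronskian of
    A and B; unless A and B are proportional there are finitely many of those,
    and each excludes at most one u ([pencil_separable]).

    Finally, zero divisors turn products into sums ([zero_divisorM]) and
    substitutions respect products, so the statement on divisors reduces to
    linear forms ([zero_divisor_form_act]). *)

Local Open Scope ring_scope.
Set Implicit Arguments.
Unset Strict Implicit.
Unset Printing Implicit Defensive.
Import GRing.Theory Num.Theory.

(** * Resultants of binary forms *)

Section FormalResultant.
Variable R : comNzRingType.
Implicit Types (p q r : {poly R}) (a b s m : nat) (F : nat -> {poly R}).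

Definition poly_rows a s F : 'M[R]_(a, s) :=
  \matrix_(i, j) (F i)`_j.

Lemma eq_poly_rows a s (F G : nat -> {poly R}) :
  (forall i, (i < a)%N -> F i = G i) -> poly_rows a s F = poly_rows a s G.
Proof. by move=> eqFG; apply/matrixP => i j; rewrite !mxE eqFG. Qed.

(** The second factor is the matrix of [phi] in the monomial basis: row
    operations and substitutions on Sylvester matrices are both of this form. *)
Lemma poly_rows_linear a b s (phi : {linear {poly R} -> {poly R}}) F :
  (forall i, (i < a)%N -> (size (F i) <= b)%N) ->
  poly_rows a b F *m poly_rows b s (fun k => phi 'X^k) =
  poly_rows a s (fun i => phi (F i)).
Proof.
move=> szF; apply/matrixP => i j; rewrite !mxE.
rewrite -[F i in RHS](coefK (F i)) (poly_def (size (F i))).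
rewrite (big_ord_widen b (fun k => (F i)`_k *: 'X^k)) ?szF // [in RHS]big_mkcond /=.
rewrite linear_sum coef_sum; apply: eq_bigr => k _; rewrite !mxE.
case: ltnP => [_|le_k]; first by rewrite linearZ coefZ.
by rewrite nth_default // mul0r linear0 coef0.
Qed.

Lemma poly_rows_mul a b s q F :
  (forall i, (i < a)%N -> (size (F i) <= b)%N) ->
  poly_rows a b F *m poly_rows b s (fun k => 'X^k * q) =
  poly_rows a s (fun i => F i * q).
Proof. exact: (poly_rows_linear s (q \o* idfun)). Qed.

(** The resultant of a form [p] of degree [b] and a form [q] of degree [a].
    The formal degrees are arguments, not read off the sizes, so that the
    resultant commutes with every specialization of the coefficients. *)
Definition form_resultant a b p q : R :=
  \det (col_mx (poly_rows a (a + b) (fun i => 'X^i * p))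
               (poly_rows b (a + b) (fun i => 'X^i * q))).

Lemma resultant_form p q :
  resultant p q = form_resultant (size q).-1 (size p).-1 p q.
Proof.
congr (\det (col_mx _ _));
  by apply/matrixP => i j; rewrite !mxE /= rVpoly_delta.
Qed.

Lemma form_resultantZ a b c d p q :
  form_resultant a b (c *: p) (d *: q) =
  c ^+ a * d ^+ b * form_resultant a b p q.
Proof.
rewrite /form_resultant -[c ^+ a]det_scalar -[d ^+ b]det_scalar.
rewrite -(det_lblock _ 0) -det_mulmx mul_block_col !mul0mx addr0 add0r.
rewrite !mul_scalar_mx; congr (\det (col_mx _ _));
  by apply/matrixP => i j; rewrite !mxE -scalerAr coefZ.
Qed.

(** Adding [r * q] to [p] adds to each row ['X^i * p] a combination of the rows
    ['X^j * q]; the bound on [size r] says that all of those are present. *)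
Lemma form_resultantDMl a b p q r :
  (a + size r <= b.+1)%N ->
  form_resultant a b (p + r * q) q = form_resultant a b p q.
Proof.
move=> szr; have szXr i : (i < a)%N -> (size ('X^i * r)%R <= b)%N.
  move=> lt_i; apply: leq_trans (size_polyMleq _ _) _.
  rewrite size_polyXn addSn /= -ltnS; apply: leq_trans szr.
  by rewrite -addSn leq_add2r.
pose U : 'M[R]_(a + b) := block_mx 1%:M (poly_rows a b (fun i => 'X^i * r)) 0 1%:M.
have detU : \det U = 1 by rewrite det_ublock !det1 mulr1.
rewrite /form_resultant -[RHS]mul1r -detU -det_mulmx.
rewrite mul_block_col mul0mx add0r !mul1mx poly_rows_mul //.
congr (\det (col_mx _ _)).
by apply/matrixP => i j; rewrite !mxE -coefD mulrDr mulrA.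
Qed.

Lemma det_poly_rows_recr s F :
  (forall i, (i < s)%N -> (size (F i) <= s)%N) ->
  \det (poly_rows s.+1 s.+1 F) = (F s)`_s * \det (poly_rows s s F).
Proof.
move=> szF; rewrite (expand_det_col _ ord_max) big_ord_recr /= big1 => [|i _].
  rewrite add0r mxE /cofactor -signr_odd oddD addbb expr0 mul1r.
  congr (_ * \det _); apply/matrixP => i j; rewrite !mxE.
  by rewrite !lift_max.
by rewrite mxE /= nth_default ?mul0r // szF.
Qed.

Lemma form_resultant_rows a b p q :
  form_resultant a b p q =
  \det (poly_rows (a + b) (a + b)
          (fun i => if (i < a)%N then 'X^i * p else 'X^(i - a) * q)).
Proof.
congr (\det _); apply/matrixP => i j; rewrite !mxE.
case: splitP => k /= ->; rewrite mxE ?ltn_ord //.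
by rewrite addKn.
Qed.

(** The form of degree [m.+1] given by [p] is divisible by y: the last column of
    the matrix has [q`_m], in the last row, as its only nonzero entry. *)
Lemma form_resultant_recr m p q :
  (size p <= m.+1)%N -> (size q <= m.+1)%N ->
  form_resultant m m.+1 p q = q`_m * form_resultant m m p q.
Proof.
move=> szp szq; rewrite !form_resultant_rows addnS det_poly_rows_recr => [|i lt_i].
  by rewrite ltnNge leq_addr /= addKn coefXnM ltnNge leq_addr /= addKn.
have szX k r : (k < m)%N -> (size r <= m.+1)%N -> (size ('X^k * r)%R <= m + m)%N.
  move=> lt_k szr; apply: leq_trans (size_polyMleq _ _) _.
  by have:= leq_add lt_k szr; rewrite size_polyXn addnS !addSn ltnS.
case: ltnP => [/szX->//|le_mi]; apply: szX => //.
by rewrite ltn_subLR.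
Qed.

End FormalResultant.
Lemma map_form_resultant (R S : comNzRingType) (f : {rmorphism R -> S}) a b p q :
  f (form_resultant a b p q) = form_resultant a b (map_poly f p) (map_poly f q).
Proof.
rewrite /form_resultant -det_map_mx map_col_mx; congr (\det (col_mx _ _));
  by apply/matrixP => i j; rewrite !mxE !coefXnM coef_map; case: ifP; rewrite ?rmorph0.
Qed.

(** * The discriminant as the resultant of the two partial derivatives *)

Section FormalDiscriminant.
Variable R : comNzRingType.
Implicit Types (f g : {poly R}) (n m : nat).

(** Euler's relation gives the y-derivative, in the chart y = 1, of the
    homogenization of [f] in degree [n]. *)
Definition deriv_y n f : {poly R} := f *+ n - 'X * f^`().

(** The degree of the form is [m.+1], so that the determinant has size
    [m + m], the degree of the discriminant in the coefficients. *)
Definition form_discr m f : R := form_resultant m m (deriv_y m.+1 f) f^`().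

Lemma deriv_yZ n c f : deriv_y n (c *: f) = c *: deriv_y n f.
Proof. by rewrite /deriv_y derivZ scalerBr scalerMnr -scalerAr. Qed.

Lemma coef_deriv_y n f i : (size f <= n.+1)%N -> (deriv_y n f)`_i = f`_i *+ (n - i).
Proof.
move=> szf; rewrite coefB coefMn coefXM coef_deriv.
case: i => [|i] /=; first by rewrite subr0 subn0.
have [le_in|lt_ni] := leqP i.+1 n; first by rewrite mulrnBr.
by rewrite nth_default ?mul0rn ?subr0 // (leq_trans szf).
Qed.

Lemma size_deriv_y n f : (size f <= n.+1)%N -> (size (deriv_y n f) <= n)%N.
Proof.
move=> szf; apply/leq_sizeP => i le_ni.
by rewrite coef_deriv_y // (eqP le_ni).
Qed.

Lemma size_deriv_leq n f : (size f <= n.+1)%N -> (size f^`() <= n)%N.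
Proof.
move=> szf; apply/leq_sizeP => i le_ni.
by rewrite coef_deriv nth_default ?mul0rn // (leq_trans szf).
Qed.

Lemma form_discrZ m c f : form_discr m (c *: f) = c ^+ (m + m) * form_discr m f.
Proof. by rewrite /form_discr deriv_yZ derivZ form_resultantZ exprD. Qed.

(** Multiplying the [m] rows that come from [f] by [m.+1] and subtracting
    ['X * f^`()] replaces [f] by [deriv_y m.+1 f] ; the last column then splits
    off the leading coefficient of [f^`()]. *)
Lemma resultant_deriv m f :
  size f = m.+2 -> size f^`() = m.+1 ->
  m.+1%:R ^+ m * resultant f f^`() = lead_coef f *+ m.+1 * form_discr m f.
Proof.
move=> szf szf'; rewrite resultant_form szf szf' /=.
have /esym := form_resultantZ m m.+1 m.+1%:R 1 f f^`().
rewrite expr1n mulr1 scale1r => ->.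
have -> : m.+1%:R *: f = deriv_y m.+1 f + 'X * f^`() by rewrite /deriv_y subrK scaler_nat.
rewrite form_resultantDMl ?size_polyX ?addn2 //.
rewrite form_resultant_recr ?size_deriv_y ?szf ?szf' //.
by rewrite coef_deriv lead_coefE szf.
Qed.

End FormalDiscriminant.

Lemma map_form_discr (R S : comNzRingType) (f : {rmorphism R -> S}) m p :
  f (form_discr m p) = form_discr m (map_poly f p).
Proof.
rewrite /form_discr map_form_resultant -deriv_map /deriv_y.
by rewrite rmorphB rmorphMn rmorphM /= map_polyX deriv_map.
Qed.

Lemma natr_eq0_char0 (R : idomainType) n :
  has_char0 R -> (n%:R == 0 :> R) = (n == 0%N).
Proof. by move/pcharf0P. Qed.

Lemma size_deriv_char0 (R : idomainType) (f : {poly R}) : has_char0 R ->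
  size f^`() = (size f).-1.
Proof.
move=> char0.
have [szf | szf] := ltnP 1 (size f); last first.
  by rewrite (size1_polyC szf) derivC size_poly0 size_polyC; case: eqP.
case szfE: (size f) szf => [|[|n]] //= _.
apply/eqP; rewrite eqn_leq size_deriv_leq ?szfE // ltnNge.
apply/negP => /leq_sizeP /(_ n (leqnn _)) /eqP.
have := lead_coef_eq0 f; rewrite lead_coefE szfE coef_deriv => f0.
by rewrite -mulr_natr mulf_eq0 natr_eq0_char0 // orbF f0 -size_poly_eq0 szfE.
Qed.

Section PolyCoefDiscriminant.
Variable F : fieldType.
Hypothesis char0 : has_char0 F.

Lemma char0_poly : has_char0 {poly F}.
Proof.
by apply/pcharf0P => i; rewrite -polyC_natr polyC_eq0 (natr_eq0_char0 _ char0).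
Qed.

(** The exact quotient that defines the discriminant is, up to a constant, the
    resultant of the partial derivatives, which needs no division. *)
Lemma discriminant_form m (h : {poly {poly F}}) : size h = m.+2 ->
  exists2 c : F, c != 0 & discriminant h = c *: form_discr m h.
Proof.
move=> szh; pose n : F := m.+1%:R.
have n0 : n != 0 by rewrite (natr_eq0_char0 _ char0).
have lh0 : lead_coef h != 0 by rewrite lead_coef_eq0 -size_poly_eq0 szh.
have szh' : size h^`() = m.+1 by rewrite size_deriv_char0 ?szh //; exact: char0_poly.
have Dres : resultant h h^`() = (n / n ^+ m) *: (form_discr m h * lead_coef h).
  apply: (scalerI (expf_neq0 m n0)).
  rewrite scalerA mulrCA divff ?expf_neq0 // mulr1.
  have := resultant_deriv szh szh'.
  rewrite -!mul_polyC rmorphXn /n /= !polyC_natr => ->.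
  by rewrite mulr_natl -mulrnAr mulrC.
exists ((-1) ^+ 'C((size h).-1, 2) * (n / n ^+ m)).
  by rewrite !mulf_neq0 ?signr_eq0 ?invr_eq0 ?expf_neq0.
rewrite /discriminant Dres scalerAl mulpK // -[in RHS]scalerA -[in RHS]mul_polyC.
by rewrite polyC_exp polyCN polyC1.
Qed.

Lemma size_det_leq s (A : 'M[{poly F}]_s) :
  (forall i j, size (A i j) <= 2)%N -> (size (\det A) <= s.+1)%N.
Proof.
move=> szA; apply: leq_trans (size_sum _ _ _) _; apply/bigmax_leqP => g _.
rewrite size_Msign.
apply: leq_trans (size_prod_leq _ _) _.
rewrite leq_subLR card_ord addnS ltnS.
apply: (@leq_trans (\sum_(i < s) 2)%N); first exact: leq_sum.
by rewrite sum_nat_const card_ord muln2 addnn.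
Qed.

Lemma size_form_discr m (h : {poly {poly F}}) : (size h <= m.+2)%N ->
  (forall i, (size (h`_i)%R <= 2)%N) -> (size (form_discr m h) <= (m + m).+1)%N.
Proof.
move=> szh szhi; apply: size_det_leq => i j.
have szMn (p : {poly F}) k : (size p <= 2)%N -> (size (p *+ k) <= 2)%N.
  move=> szp; apply/leq_sizeP => l le_l.
  by rewrite coefMn nth_default ?mul0rn // (leq_trans szp).
rewrite mxE; case: split => k; rewrite mxE coefXnM; case: ifP => _;
  rewrite ?size_poly0 //.
- by rewrite coef_deriv_y // szMn.
- by rewrite coef_deriv szMn.
Qed.

End PolyCoefDiscriminant.
(** * Linear substitutions in binary forms *)

Section Substitution.
Variable F : closedFieldType.
Implicit Types (f g p q : {poly F}) (n m a b s : nat) (z u : F).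

(** Evaluation formulas such as [form_actE] hold off a finite set; over an
    infinite field they still determine the polynomials. *)
Lemma poly_eq_off (l p q : {poly F}) :
  l != 0 -> (forall z, l.[z] != 0 -> p.[z] = q.[z]) -> p = q.
Proof.
move=> l0 eq_pq; apply/eqP; rewrite -subr_eq0; apply/contraT => npq.
have /closed_nonrootP[z] : l * (p - q) != 0 by rewrite mulf_neq0.
rewrite rootM negb_or => /andP[lz].
by rewrite rootE hornerD hornerN eq_pq ?subrr ?eqxx.
Qed.

Variables al be ga de : F.
Local Notation act := (form_act al be ga de).
Local Notation L1 := (de *: 'X - be%:P).
Local Notation L2 := (al%:P - ga *: 'X).

Lemma form_act_is_linear n : linear (act n).
Proof.
move=> c p q; rewrite /form_act scaler_sumr -big_split; apply: eq_bigr => i _.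
by rewrite coefD coefZ scalerDl scalerA.
Qed.
HB.instance Definition _ n := GRing.isLinear.Build F {poly F} {poly F} _ (act n)
  (form_act_is_linear n).

Lemma size_lin1 : (size L1 <= 2)%N.
Proof.
apply: leq_trans (size_polyD _ _) _; rewrite geq_max size_polyN size_polyC.
by rewrite (leq_trans (size_scale_leq _ _)) ?size_polyX //; case: eqP.
Qed.

Lemma size_lin2 : (size L2 <= 2)%N.
Proof.
apply: leq_trans (size_polyD _ _) _; rewrite geq_max size_polyN size_polyC.
by rewrite (leq_trans (size_scale_leq _ _)) ?size_polyX // andbT; case: eqP.
Qed.

Lemma size_exp_lin p n : (size p <= 2)%N -> (size (p ^+ n) <= n.+1)%N.
Proof.
move=> szp; apply: leq_trans (size_poly_exp_leq _ _) _; rewrite ltnS.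
by case: (size p) szp => [|[|[]]] //= _; rewrite mul1n.
Qed.

Lemma size_form_act n f : (size (act n f) <= n.+1)%N.
Proof.
apply: leq_trans (size_sum _ _ _) _; apply/bigmax_leqP => i _.
apply: leq_trans (size_scale_leq _ _) _.
apply: leq_trans (size_polyMleq _ _) _.
have := leq_add (size_exp_lin i size_lin1) (size_exp_lin (n - i) size_lin2).
rewrite addSn addnS subnKC -1?ltnS // => szL.
by rewrite -subn1 leq_subLR add1n.
Qed.

Section Derivatives.
Local Notation T i j := (L1 ^+ i * L2 ^+ j).

Lemma form_act_deriv n f :
  act n f^`() = \sum_(i < n.+2) f`_i *: (T i.-1 (n.+1 - i) *+ i).
Proof.
rewrite big_ord_recl mulr0n scaler0 add0r; apply: eq_bigr => i _.
by rewrite coef_deriv -scalerMnl scalerMnr.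
Qed.

Lemma form_act_deriv_y n f : (size f <= n.+2)%N ->
  act n (deriv_y n.+1 f) = \sum_(i < n.+2) f`_i *: (T i (n.+1 - i).-1 *+ (n.+1 - i)).
Proof.
move=> szf; rewrite big_ord_recr /= subnn mulr0n scaler0 addr0.
by apply: eq_bigr => i _; rewrite coef_deriv_y // subSn -1?ltnS //= -scalerMnl scalerMnr.
Qed.

Lemma deriv_monomial i j :
  (T i j)^`() = de *: (T i.-1 j *+ i) - ga *: (T i j.-1 *+ j).
Proof.
have dL1 : L1^`() = de%:P by rewrite derivB derivZ derivX derivC subr0 alg_polyC.
have dL2 : L2^`() = - ga%:P by rewrite derivB derivZ derivX derivC sub0r alg_polyC.
rewrite derivM !deriv_exp dL1 dL2 -!mul_polyC mulNr mulNrn mulrN.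
congr (_ - _); first by rewrite mulrnAl mulrnAr mulrA.
by rewrite !mulrnAr mulrCA.
Qed.

Lemma deriv_y_monomial i j :
  deriv_y (i + j) (T i j) = al *: (T i j.-1 *+ j) - be *: (T i.-1 j *+ i).
Proof.
rewrite /deriv_y deriv_monomial mulrnDr mulrBr opprB.
have -> : T i j *+ i = L1 * (T i.-1 j *+ i).
  by case: i => [|i] /=; rewrite ?mulr0n ?mulr0 // exprS -mulrA mulrnAr.
have -> : T i j *+ j = L2 * (T i j.-1 *+ j).
  by case: j => [|j] /=; rewrite ?mulr0n ?mulr0 // exprS mulrCA mulrnAr.
by rewrite -!mul_polyC; ring.
Qed.

(** Chain rule for the substitution (x, y) := (de x - be y, - ga x + al y),
    checked on monomials. *)
Lemma deriv_form_act n f : (size f <= n.+2)%N ->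
  (act n.+1 f)^`() = de *: act n f^`() - ga *: act n (deriv_y n.+1 f).
Proof.
move=> szf; rewrite form_act_deriv form_act_deriv_y // !scaler_sumr -sumrB linear_sum /=.
apply: eq_bigr => i _; rewrite derivZ deriv_monomial scalerBr.
by rewrite !scalerA ![_ * f`_i]mulrC.
Qed.

Lemma deriv_y_form_act n f : (size f <= n.+2)%N ->
  deriv_y n.+1 (act n.+1 f) = al *: act n (deriv_y n.+1 f) - be *: act n f^`().
Proof.
move=> szf; rewrite form_act_deriv form_act_deriv_y // !scaler_sumr -sumrB.
rewrite /deriv_y linear_sum mulr_sumr -sumrMnl -sumrB; apply: eq_bigr => i _.
rewrite -/(deriv_y n.+1 _) deriv_yZ.
have := deriv_y_monomial i (n.+1 - i); rewrite subnKC -1?ltnS // => ->.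
by rewrite scalerBr !scalerA ![_ * f`_i]mulrC.
Qed.

End Derivatives.

Hypothesis det_neq0 : al * de - be * ga != 0.

Lemma horner_lin2 z : L2.[z] = - ga * z + al.
Proof. by rewrite !hornerE mulNr addrC. Qed.

Lemma lin2_neq0 : L2 != 0.
Proof.
apply: contra_neq det_neq0 => L20.
have := congr1 (fun p => p`_0) L20; have := congr1 (fun p => p`_1) L20.
rewrite !coefE /= mulr1 mulr0 sub0r subr0 => /eqP; rewrite oppr_eq0 => /eqP -> ->.
by rewrite mul0r mulr0 subr0.
Qed.

Lemma form_actM m n f g : (size f <= m.+1)%N -> (size g <= n.+1)%N ->
  act (m + n) (f * g) = act m f * act n g.
Proof.
move=> szf szg; apply: (poly_eq_off lin2_neq0) => z; rewrite horner_lin2 => nz.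
have szfg : (size (f * g)%R <= (m + n).+1)%N.
  apply: leq_trans (size_polyMleq _ _) _.
  by have := leq_add szf szg; case: (_ + _)%N => // k; rewrite addnS.
by rewrite hornerM !form_actE // hornerM exprD mulrACA.
Qed.

(** A form annihilated by the substitution vanishes at every [x] that is of
    the form g^-1(z), hence everywhere. *)
Lemma form_act_inj n f : (size f <= n.+1)%N -> act n f = 0 -> f = 0.
Proof.
move=> szf act0; pose l := ga *: 'X + de%:P.
have l0 : l != 0.
  apply: contra_neq det_neq0 => l0.
  have := congr1 (fun p => p`_0) l0; have := congr1 (fun p => p`_1) l0.
  rewrite !coefE /= mulr1 mulr0 addr0 add0r => -> ->.
  by rewrite !mulr0 subr0.
apply: (poly_eq_off l0) => x; rewrite !hornerE => lx.
pose z := (al * x + be) / (ga * x + de).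
have tE : - ga * z + al = (al * de - be * ga) / (ga * x + de).
  by rewrite /z; field.
have xE : (de * z - be) / (- ga * z + al) = x.
  by rewrite tE /z; field; rewrite lx det_neq0.
have t0 : - ga * z + al != 0 by rewrite tE mulf_neq0 ?invr_eq0.
have /esym/eqP := form_actE be de szf t0.
by rewrite act0 horner0 xE mulf_eq0 expf_eq0 (negPf t0) andbF => /eqP.
Qed.

Definition subst_mx s : 'M[F]_s := poly_rows s s (fun k => act s.-1 'X^k).

(** A vector in the kernel is the coefficient vector of a form annihilated by
    the substitution. *)
Lemma det_subst_mx s : \det (subst_mx s) != 0.
Proof.
case: s => [|s]; first by rewrite det_mx00 oner_eq0.
apply/det0P => -[v v0 vS]; case/negP: v0; apply/eqP.
rewrite -[v]rVpolyK (@form_act_inj s (rVpoly v)) ?linear0 ?size_poly //.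
apply/polyP => j; rewrite coef0; have [le_sj|lt_js] := leqP s.+1 j.
  by rewrite nth_default // (leq_trans (size_form_act _ _)).
have := poly_rows_linear s.+1 (act s : {linear {poly F} -> {poly F}})
  (a := 1) (b := s.+1) (fun _ _ => size_poly _ _ : (size (rVpoly v) <= s.+1)%N).
have -> : poly_rows 1 s.+1 (fun=> rVpoly v) = v.
  by apply/matrixP => i k; rewrite mxE coef_rVpoly_ord ord1.
rewrite -/(subst_mx s.+1) vS => /matrixP /(_ 0 (Ordinal lt_js)).
by rewrite !mxE.
Qed.

(** The rows of the Sylvester matrix are the products ['X^i * p].  Substituting
    in them, in degree [a + b - 1], is multiplication on the right by
    [subst_mx (a + b)] ; as substitution is multiplicative, it also amounts to
    substituting in [p] and, by multiplication on the left, in ['X^i]. *)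
Lemma form_resultant_act a b p q :
  (size p <= b.+1)%N -> (size q <= a.+1)%N ->
  \det (subst_mx a) * \det (subst_mx b) *
    form_resultant a b (act b p) (act a q) =
  form_resultant a b p q * \det (subst_mx (a + b)).
Proof.
move=> szp szq; rewrite -(det_lblock _ 0) /form_resultant -!det_mulmx.
rewrite mul_block_col !mul0mx addr0 add0r mul_col_mx.
have rowE c n s (r : {poly F}) : s = (c + n)%N -> (size r <= n.+1)%N ->
    subst_mx c *m poly_rows c s (fun i => 'X^i * act n r) =
    poly_rows c s (fun i => 'X^i * r) *m subst_mx s.
  move=> -> szr; rewrite poly_rows_mul => [|i lt_i]; last first.
    by rewrite (leq_trans (size_form_act _ _)) // (ltn_predK lt_i).
  rewrite poly_rows_linear => [|i lt_i]; last first.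
    apply: leq_trans (size_polyMleq _ _) _; rewrite size_polyXn addSn /=.
    by have := leq_add lt_i szr; rewrite addSn addnS ltnS.
  apply: eq_poly_rows => i lt_i; case: c lt_i => // c lt_i.
  by rewrite addSn /= form_actM // size_polyXn.
by congr (\det (col_mx _ _)); apply: rowE; rewrite // addnC.
Qed.

(** The chain rule mixes the two partial derivatives; on Sylvester matrices
    this is a left multiplication by a block matrix of scalar matrices, and
    [B] below is its adjugate. *)
Lemma form_resultant_lin m : exists2 c : F, c != 0 &
  forall p q, form_resultant m m (al *: p - be *: q) (de *: q - ga *: p) =
    c * form_resultant m m p q.
Proof.
pose A : 'M[F]_(m + m) := block_mx al%:M (- be)%:M (- ga)%:M de%:M.
pose B : 'M[F]_(m + m) := block_mx de%:M be%:M ga%:M al%:M.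
exists (\det A) => [|p q]; last first.
  rewrite /form_resultant -det_mulmx mul_block_col !mul_scalar_mx.
  congr (\det (col_mx _ _)); apply/matrixP => i j;
    rewrite !mxE !coefXnM; case: ifP => _; rewrite ?mulr0 ?addr0 //;
    by rewrite !coefE ?mulNr // addrC.
have : \det (A *m B) != 0.
  rewrite mulmx_block -!scalar_mxM -!raddfD /= !mulNr.
  rewrite [de * ga]mulrC addNr raddf0 det_ublock !det_scalar.
  by rewrite mulf_neq0 ?expf_neq0 // addrC mulrC [ga * be]mulrC.
by rewrite det_mulmx mulf_eq0 negb_or => /andP[].
Qed.

Lemma form_discr_act m : exists2 c : F, c != 0 &
  forall f, (size f <= m.+2)%N ->
    form_discr m (act m.+1 f) = c * form_discr m f.
Proof.
have [c c0 lin_c] := form_resultant_lin m.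
pose s := \det (subst_mx m); pose t := \det (subst_mx (m + m)).
have [s0 t0] : s != 0 /\ t != 0 by split; apply: det_subst_mx.
exists (c * (t / (s * s))) => [|f szf].
  by rewrite !mulf_neq0 ?invr_eq0 ?mulf_neq0.
rewrite /form_discr deriv_y_form_act // deriv_form_act // lin_c -mulrA; congr (_ * _).
apply: (mulfI (mulf_neq0 s0 s0)).
rewrite form_resultant_act ?size_deriv_y ?size_deriv_leq // -/t.
by field; rewrite s0.
Qed.

End Substitution.
(** * The polar derivative and its covariance *)

Section Polar.
Variable F : closedFieldType.
Implicit Types (p q : {poly F}) (w : {poly F} * {poly F}) (d k n : nat) (u : F).

(** The derivative in the direction (u, 1), in the chart y = 1, of the
    homogenization of [p] in degree [n]. *)
Definition deriv_dir n u p : {poly F} := u *: p^`() + deriv_y n p.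

(** The numerator of the polar derivative at a scalar [u]. *)
Definition polar d w u : {poly F} :=
  w.1 * w.2 *+ d + (u%:P - 'X) * (w.1^`() * w.2 - w.1 * w.2^`()).

(** The Leibniz rule for the quotient of two forms whose degrees differ by
    [d]; this is the shape in which covariance is visible. *)
Lemma polar_deriv_dir d k w u :
  polar d w u = deriv_dir (d + k) u w.1 * w.2 - w.1 * deriv_dir k u w.2.
Proof.
by rewrite /polar /deriv_dir /deriv_y -!mul_polyC; ring.
Qed.

Lemma size_deriv_dir n u p : (size p <= n.+1)%N -> (size (deriv_dir n u p) <= n)%N.
Proof.
move=> szp; apply: leq_trans (size_polyD _ _) _.
by rewrite geq_max (leq_trans (size_scale_leq _ _)) ?size_deriv_leq ?size_deriv_y.
Qed.

Lemma map_polar_num d w u :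
  map_poly (horner_eval u) (polar_num d w) = polar d w u.
Proof.
have evC p : map_poly (horner_eval u) p^:P = p.
  by rewrite -map_poly_comp map_poly_id // => c _; rewrite /= /horner_eval hornerC.
rewrite /polar_num /polar; move: (w.1 * w.2) (_ - _ * _^`()) => P B.
rewrite rmorphD rmorphMn rmorphM /= !evC; congr (_ + _ * _).
by rewrite rmorphB /= map_polyC map_polyX /= /horner_eval hornerX.
Qed.

Lemma coef_polar_num d w i :
  (polar_num d w)`_i = ((polar d w 0)`_i)%:P
    + (w.1^`() * w.2 - w.1 * w.2^`())`_i *: 'X.
Proof.
rewrite /polar_num /polar; move: (_ - _ * _^`()) => B.
rewrite sub0r mulrBl mulNr !coefD coefMn coefN coefCM !coef_map coefXM /=.
rewrite coefN coefXM coefMn.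
rewrite -[_ *: 'X]mul_polyC.
by case: i => [|i] /=; rewrite ?coef_map !(polyC0, polyCD, polyCN, polyCMn) /=; ring.
Qed.

Section Degrees.
Variables (d k : nat) (w : {poly F} * {poly F}).
Hypotheses (d_gt0 : (0 < d)%N) (char0 : has_char0 F).
Hypotheses (szp : size w.1 = (d + k).+1) (szq : size w.2 = k.+1).

Let B := w.1^`() * w.2 - w.1 * w.2^`().

Lemma size_polar u : (size (polar d w u) <= d + k + k)%N.
Proof.
rewrite (polar_deriv_dir d k).
have szM (r s : {poly F}) a b : (size r <= a)%N -> (size s <= b.+1)%N ->
    (size (r * s)%R <= a + b)%N.
  move=> szr szs; apply: leq_trans (size_polyMleq _ _) _.
  by have := leq_add szr szs; rewrite addnS -subn1 leq_subLR.
apply: leq_trans (size_polyD _ _) _; rewrite size_polyN geq_max.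
rewrite szM ?size_deriv_dir ?szp ?szq // mulrC.
by rewrite [(d + k + k)%N]addnC szM ?size_deriv_dir ?szp ?szq.
Qed.

Lemma polarE u : polar d w u = polar d w 0 + u *: B.
Proof. by rewrite /polar -/B -!mul_polyC; ring. Qed.

(** The top coefficient of [w.1 * w.2 *+ d] is nonzero, and in
    [polar d w 0 + 'X * B] only ['X * B] can produce it. *)
Lemma size_polarB : size B = (d + k + k)%N.
Proof.
have szB : (size B <= d + k + k)%N.
  have -> : B = polar d w 1 - polar d w 0 by rewrite [polar d w 1]polarE scale1r addrC addKr.
  by rewrite (leq_trans (size_polyD _ _)) // size_polyN geq_max !size_polar.
apply/eqP; rewrite eqn_leq szB /=.
have [p0 q0] : w.1 != 0 /\ w.2 != 0.
  by rewrite -!size_poly_eq0 szp szq.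
have szpq : size (w.1 * w.2) = (d + k + k).+1.
  by rewrite size_mul // szp szq addnS.
case Dn: (d + k + k)%N szB szpq => [|n] szB szpq.
  by move: Dn d_gt0; case: (d).
rewrite ltnNge; apply/negP => /leq_sizeP /(_ n (leqnn _)) Bn0.
have : (polar d w 0 + 'X * B)`_n.+1 == (w.1 * w.2 *+ d)`_n.+1.
  by rewrite /polar -/B sub0r mulNr subrK.
rewrite coefD coefXM /= Bn0 addr0 nth_default; last by rewrite -Dn size_polar.
rewrite coefMn eq_sym -mulr_natr mulf_eq0.
have := lead_coef_eq0 (w.1 * w.2); rewrite lead_coefE szpq /= => ->.
by rewrite -size_poly_eq0 szpq (natr_eq0_char0 _ char0) eqn0Ngt d_gt0.
Qed.

Lemma size_polar_num : size (polar_num d w) = (d + k + k)%N.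
Proof.
apply/eqP; rewrite eqn_leq; apply/andP; split.
  apply/leq_sizeP => i le_i; rewrite coef_polar_num -/B.
  have [Ai Bi] : (polar d w 0)`_i = 0 /\ B`_i = 0.
    split; apply: nth_default; first exact: leq_trans (size_polar 0) _.
    by rewrite size_polarB.
  by rewrite Ai Bi scale0r addr0.
case Dn: (d + k + k)%N => [|n] //.
rewrite ltnNge; apply/negP => /leq_sizeP /(_ n (leqnn _)).
move/(congr1 (fun c : {poly F} => c`_1)); rewrite coef_polar_num -/B.
rewrite coefD coefC coefZ coefX coef0 add0r mulr1 => /eqP.
have := lead_coef_eq0 B; rewrite lead_coefE size_polarB Dn /= => ->.
by rewrite -size_poly_eq0 size_polarB Dn.
Qed.

Lemma size_coef_polar_num i : (size ((polar_num d w)`_i)%R <= 2)%N.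
Proof.
rewrite coef_polar_num (leq_trans (size_polyD _ _)) // geq_max.
rewrite (leq_trans (size_polyC_leq1 _)) //.
by rewrite (leq_trans (size_scale_leq _ _)) ?size_polyX.
Qed.

End Degrees.

Section Covariance.
Variables al be ga de : F.
Hypothesis det_neq0 : al * de - be * ga != 0.
Local Notation act := (form_act al be ga de).

(** The substitution sends the direction (u, 1) to (de u - be, - ga u + al),
    which is proportional to (g^-1(u), 1). *)
Lemma deriv_dir_form_act n u p :
  - ga * u + al != 0 -> (size p <= n.+2)%N ->
  deriv_dir n.+1 u (act n.+1 p) =
  (- ga * u + al) *: act n (deriv_dir n.+1 ((de * u - be) / (- ga * u + al)) p).
Proof.
move=> t0 szp; rewrite /deriv_dir deriv_form_act // deriv_y_form_act //.
rewrite form_act_is_linear [RHS]scalerDr [in RHS]scalerA.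
rewrite [in RHS]mulrCA divff // mulr1 -!mul_polyC !(polyCD, polyCN, polyCM).
by ring.
Qed.

Lemma polar_rat_act d k w u :
  - ga * u + al != 0 -> (0 < d)%N ->
  (size w.1 <= (d + k).+1)%N -> (size w.2 <= k.+1)%N ->
  polar d (rat_act al be ga de d k w) u =
  (- ga * u + al) *:
    act (d + k + k).-1 (polar d w ((de * u - be) / (- ga * u + al))).
Proof.
move=> t0; case: d => // d _ szp szq; rewrite !(polar_deriv_dir _ k) /=.
rewrite !addSn /= linearB /= scalerBr; congr (_ - _).
  by rewrite deriv_dir_form_act // -scalerAl -form_actM ?size_deriv_dir.
(* For k = 0 the degree k - 1 is truncated, but the term is zero. *)
case: k szp szq => [|k] szp szq.
  have deriv_dir0 (r : {poly F}) v : (size r <= 1)%N -> deriv_dir 0 v r = 0.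
    by move=> szr; rewrite /deriv_dir /deriv_y (size1_polyC szr) derivC scaler0 mulr0 subr0 addr0.
  by rewrite !deriv_dir0 ?size_form_act // !mulr0 linear0 scaler0.
rewrite deriv_dir_form_act // -scalerAr -form_actM ?size_deriv_dir //.
by rewrite addSnnS.
Qed.

End Covariance.
End Polar.
(** * Separable members of a pencil *)

Section Pencil.
Variable F : closedFieldType.
Hypothesis char0 : has_char0 F.
Implicit Types A B E f : {poly F}.

Lemma lead_coef_deriv A : lead_coef A^`() = lead_coef A *+ (size A).-1.
Proof.
rewrite lead_coefE size_deriv_char0 // coef_deriv lead_coefE.
by case szA: (size A) => [|[|n]] //=; rewrite mulr0n mulr1n nth_default ?szA.
Qed.

(** The leading coefficients of the two products differ by the factors
    [(size B).-1] and [(size E).-1]. *)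
Lemma wronskian_neq0 E B : E != 0 -> (size E < size B)%N ->
  E * B^`() - E^`() * B != 0.
Proof.
move=> E0 ltEB; rewrite subr_eq0; apply/eqP => /(congr1 lead_coef).
have B0 : B != 0 by rewrite -size_poly_gt0 (leq_trans _ ltEB).
rewrite !lead_coefM !lead_coef_deriv mulrnAr mulrnAl -mulr_natr -[X in _ = X -> _]mulr_natr.
have l0 : lead_coef E * lead_coef B != 0 by rewrite mulf_neq0 ?lead_coef_eq0.
have E_gt0 : (0 < size E)%N by rewrite size_poly_gt0.
move/(mulfI l0)/eqP; rewrite -subr_eq0 -natrB; last first.
  by rewrite -!subn1 leq_sub2r // ltnW.
by rewrite natr_eq0_char0 // subn_eq0 leqNgt -ltnS !prednK ?ltEB ?size_poly_gt0.
Qed.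

(** A double root [z] of [E + v *: B] is a root of the Wronskian of [E] and [B],
    which is nonzero unless [E = 0].  For a fixed [z], the conditions that the member and its
    derivative vanish at [z] are affine in [v] and not both trivial. *)
Lemma pencil_separable_strict E B : (size E < size B)%N ->
  (forall z, E.[z] = 0 -> B.[z] = 0 -> E^`().[z] = 0 -> B^`().[z] = 0 -> False) ->
  exists2 v, v != 0 & coprimep (E + v *: B) (E + v *: B)^`().
Proof.
move=> ltEB simple; have [E0|E0] := eqVneq E 0.
  exists 1; rewrite ?oner_eq0 // E0 add0r scale1r.
  apply: Pdiv.ClosedField.root_coprimep => z /rootP Bz; apply/eqP => B'z.
  by apply: (simple z) => //; rewrite E0 ?derivC horner0.
set W := E * B^`() - E^`() * B; have W0 : W != 0 by exact: wronskian_neq0.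
have [r Wr] := closed_field_poly_normal W.
(* The condition on the parameter, as a polynomial in it, that z imposes. *)
pose t z : {poly F} := if (E.[z] == 0) && (B.[z] == 0)
  then E^`().[z]%:P + B^`().[z] *: 'X else E.[z]%:P + B.[z] *: 'X.
have lin_neq0 (a b : F) : ~~ ((a == 0) && (b == 0)) -> a%:P + b *: 'X != 0.
  apply: contra => /eqP ab0.
  have := congr1 (fun p : {poly F} => p`_0) ab0.
  have := congr1 (fun p : {poly F} => p`_1) ab0.
  by rewrite !coefE /= mulr0 mulr1 add0r addr0 => -> ->; rewrite eqxx.
have t_neq0 z : t z != 0.
  rewrite /t; case: ifP => [/andP[/eqP Ez /eqP Bz]|/negbT/lin_neq0 //].
  by apply/lin_neq0/negP => /andP[/eqP E'z /eqP B'z]; apply: (simple z).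
(* The factor 'X keeps v nonzero, so that the degree does not drop. *)
have /closed_nonrootP[v] : 'X * \prod_(z <- r) t z != 0.
  rewrite mulf_neq0 ?polyX_eq0 // prodf_seq_neq0; apply/allP => z _; exact: t_neq0.
rewrite rootM negb_or [X in _ && ~~ X]rootE horner_prod prodf_seq_neq0 => /andP[v0 /allP tv].
exists v; first by move: v0; rewrite rootE hornerX.
apply: Pdiv.ClosedField.root_coprimep => z /rootP.
rewrite derivD derivZ !hornerE => fz; apply/eqP => f'z.
have zr : z \in r.
  have : root W z.
    have Ez : E.[z] = - (v * B.[z]) by apply/eqP; rewrite -addr_eq0 fz.
    have E'z : E^`().[z] = - (v * B^`().[z]) by apply/eqP; rewrite -addr_eq0 f'z.
    by rewrite rootE !hornerE Ez E'z; apply/eqP; ring.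
  rewrite Wr rootZ ?lead_coef_eq0 // root_prod_XsubC //.
have /negP[] := tv z zr; rewrite /t.
by case: ifP => _; rewrite !hornerE [_ * v]mulrC ?fz ?f'z.
Qed.

(** Subtracting from [A] the multiple of [B] with the same coefficient in
    degree [(size B).-1] translates the parameter and makes the degrees
    differ; this sets apart the pencils of proportional polynomials. *)
Lemma pencil_separable A B : B != 0 -> (size A <= size B)%N ->
  (forall z, A.[z] = 0 -> B.[z] = 0 -> A^`().[z] = 0 -> B^`().[z] = 0 -> False) ->
  exists u, size (A + u *: B) = size B /\
            coprimep (A + u *: B) (A + u *: B)^`().
Proof.
move=> B0 leAB simple; pose n := (size B).-1; pose c := A`_n / lead_coef B.
pose E := A - c *: B; have AE : A = E + c *: B by rewrite subrK.
have szB : size B = n.+1 by rewrite prednK // size_poly_gt0.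
have ltEB : (size E < size B)%N.
  rewrite szB ltnS; apply/leq_sizeP => i; rewrite leq_eqVlt => /predU1P[<-|lt_ni].
    by rewrite coefB coefZ -lead_coefE divfK ?lead_coef_eq0 // subrr.
  by rewrite nth_default // (leq_trans (size_polyD _ _)) // size_polyN geq_max
    (leq_trans leAB) ?(leq_trans (size_scale_leq _ _)) ?szB.
have [|v v0 cop] := pencil_separable_strict ltEB.
  move=> z Ez Bz E'z B'z; apply: (simple z) => //; rewrite AE.
    by rewrite hornerD hornerZ Ez Bz mulr0 addr0.
  by rewrite derivD derivZ hornerD hornerZ E'z B'z mulr0 addr0.
exists (v - c); have -> : A + (v - c) *: B = E + v *: B.
  by rewrite AE scalerBl addrACA addrA addrK.
by split=> //; rewrite addrC size_polyDl size_scale.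
Qed.

Lemma form_discr_neq0 m f : size f = m.+2 -> coprimep f f^`() ->
  form_discr m f != 0.
Proof.
move=> szf cop; have szf' : size f^`() = m.+1 by rewrite size_deriv_char0 // szf.
have : m.+1%:R ^+ m * resultant f f^`() != 0.
  rewrite mulf_neq0 ?expf_neq0 ?natr_eq0_char0 // resultant_eq0.
  by move: cop; rewrite /coprimep => /eqP ->.
by rewrite resultant_deriv // mulf_eq0 negb_or => /andP[].
Qed.

Lemma mup_ge3 (p : {poly F}) z : p != 0 ->
  p.[z] = 0 -> p^`().[z] = 0 -> p^`()^`().[z] = 0 -> (2 < mup z p)%N.
Proof.
move=> p0 /rootP/factor_theorem[r pr]; rewrite mup_geq // pr.
have dX (g : {poly F}) : (g * ('X - z%:P))^`() = g^`() * ('X - z%:P) + g.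
  by rewrite derivM derivB derivX derivC subr0 mulr1.
have evX (g h : {poly F}) : (g * ('X - z%:P) + h).[z] = h.[z].
  by rewrite !hornerE subrr mulr0 add0r.
rewrite dX evX derivD dX hornerD evX => /rootP/factor_theorem[s ->].
rewrite dX evX -mulr2n => /eqP.
rewrite -mulr_natr mulf_eq0 natr_eq0_char0 // orbF -/(root s z).
by move/factor_theorem => [q ->]; rewrite -!mulrA -expr2 -exprS dvdp_mull.
Qed.
End Pencil.
(** * The isodynamic polynomial *)

Section Isodynamic.
Variable F : closedFieldType.
Hypothesis char0 : has_char0 F.
Implicit Types (p q : {poly F}) (w : {poly F} * {poly F}) (d k m : nat).

Lemma wronskian_double_root p q z :
  p.[z] = 0 -> q.[z] != 0 -> let W := p^`() * q - p * q^`() in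
  W.[z] = 0 -> W^`().[z] = 0 -> p^`().[z] = 0 /\ p^`()^`().[z] = 0.
Proof.
move=> pz qz W Wz W'z.
have p'z : p^`().[z] = 0.
  by move/eqP: Wz; rewrite !hornerE pz mul0r subr0 mulf_eq0 (negPf qz) orbF => /eqP.
split=> //; move/eqP: W'z; rewrite /W derivB !derivM !hornerE p'z pz.
by rewrite !mul0r !addr0 subr0 mulf_eq0 (negPf qz) orbF => /eqP.
Qed.

(** Such a point [z] is a root of [w.1 * w.2], hence of exactly one of the two
    factors; the Wronskian [B] then forces that factor to have a triple root
    at [z]. *)
Lemma polar_no_common_double_root d k w z : (0 < d)%N -> RatStar d k w ->
  let B := w.1^`() * w.2 - w.1 * w.2^`() in
  (polar d w 0).[z] = 0 -> B.[z] = 0 -> B^`().[z] = 0 -> False.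
Proof.
move=> d_gt0 [szp szq cop mup2] B Az Bz B'z.
have [mup_p mup_q] := mup2 z.
have p0 : w.1 != 0 by rewrite -size_poly_eq0 szp.
have q0 : w.2 != 0 by rewrite -size_poly_eq0 szq.
have : (w.1 * w.2 *+ d).[z] == 0.
  have -> : w.1 * w.2 *+ d = polar d w 0 + 'X * B by rewrite /polar -/B; ring.
  by rewrite hornerD hornerM Az Bz mulr0 addr0.
rewrite hornerMn -mulr_natr mulf_eq0 natr_eq0_char0 // eqn0Ngt d_gt0 orbF.
rewrite hornerM mulf_eq0 => /orP[] rz.
  have nqz := coprimep_root cop rz.
  have [p'z p''z] := wronskian_double_root (eqP rz) nqz Bz B'z.
  by have := mup_ge3 char0 p0 (eqP rz) p'z p''z; rewrite ltnNge mup_p.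
have npz : w.1.[z] != 0 by move: cop; rewrite coprimep_sym => /coprimep_root ->.
have BE : w.2^`() * w.1 - w.2 * w.1^`() = - B by rewrite /B; ring.
have [||q'z q''z] := wronskian_double_root (eqP rz) npz.
- by rewrite BE hornerN Bz oppr0.
- by rewrite BE derivN hornerN B'z oppr0.
by have := mup_ge3 char0 q0 (eqP rz) q'z q''z; rewrite ltnNge mup_q.
Qed.

Section Degree.
Variables (d k m : nat).
Hypotheses (d_gt0 : (0 < d)%N) (dkm : (d + k + k)%N = m.+2).

Lemma horner_form_discr_polar w u :
  (form_discr m (polar_num d w)).[u] = form_discr m (polar d w u).
Proof. by rewrite -map_polar_num -[LHS]/(horner_eval u _) map_form_discr. Qed.

Lemma isodynamic_form w : size w.1 = (d + k).+1 -> size w.2 = k.+1 ->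
  exists2 c : F, c != 0 & isodynamic d w = c *: form_discr m (polar_num d w).
Proof.
by move=> szp szq; apply: discriminant_form; rewrite // (size_polar_num d_gt0 char0 szp szq).
Qed.

Lemma size_form_discr_polar w : size w.1 = (d + k).+1 -> size w.2 = k.+1 ->
  (size (form_discr m (polar_num d w)) <= (m + m).+1)%N.
Proof.
move=> szp szq; apply: size_form_discr; last exact: size_coef_polar_num.
by rewrite (size_polar_num d_gt0 char0 szp szq) dkm.
Qed.

Lemma form_discr_polar_neq0 w : RatStar d k w ->
  form_discr m (polar_num d w) != 0.
Proof.
move=> ratw; have [szp szq _ _] := ratw.
have szB := size_polarB d_gt0 char0 szp szq.
have [|||u [szf cop]] := pencil_separable char0
    (A := polar d w 0) (B := w.1^`() * w.2 - w.1 * w.2^`()).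
- by rewrite -size_poly_eq0 szB dkm.
- by rewrite szB (size_polar szp szq).
- by move=> z Az Bz _; apply: (polar_no_common_double_root d_gt0 ratw Az Bz).
rewrite -polarE in szf cop.
apply: contraTneq (form_discr_neq0 char0 (etrans szf (etrans szB dkm)) cop) => D0.
by rewrite -horner_form_discr_polar D0 horner0 eqxx.
Qed.

Variables al be ga de : F.
Hypothesis det_neq0 : al * de - be * ga != 0.

Lemma form_discr_polar_act w :
  size w.1 = (d + k).+1 -> size w.2 = k.+1 ->
  exists2 c : F, c != 0 &
    form_discr m (polar_num d (rat_act al be ga de d k w)) =
    c *: form_act al be ga de (m + m) (form_discr m (polar_num d w)).
Proof.
move=> szp szq; have [c c0 discr_act] := form_discr_act det_neq0 m.
exists c => //; apply: (poly_eq_off (lin2_neq0 det_neq0)) => u.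
rewrite horner_lin2 => t0.
rewrite hornerZ form_actE ?size_form_discr_polar // !horner_form_discr_polar.
rewrite (polar_rat_act det_neq0 t0 d_gt0) ?szp ?szq // dkm form_discrZ.
rewrite discr_act; first by rewrite mulrCA.
by rewrite -dkm size_polar.
Qed.

End Degree.
End Isodynamic.

(** * Zero divisors under Mobius transformations *)

Section DivisorsPush.
Variable F : closedFieldType.
Implicit Types (f g : {poly F}) (s t : seq F) (n a b : nat).
Local Notation "s ^P" := (\prod_(x <- s) ('X - x%:P)) (at level 2).

HB.instance Definition _ (h : option F -> option F) :=
  GRing.isZmodMorphism.Build {freeg (option F)} {freeg (option F)}
    (push_divisor h) (lift_is_additive _).

Lemma push_divisorU (h : option F -> option F) j x :
  push_divisor h << j *g x >> = << j *g h x >>.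
Proof.
rewrite /push_divisor liftU; apply/eqP/freeg_eqP => y.
by rewrite coeffZ !coeffU mul1r.
Qed.

Lemma zero_divisorE n c s : c != 0 ->
  zero_divisor n (c *: s^P) =
  \sum_(x <- s) << Some x >> + << n%:Z - (size s)%:Z *g None >>.
Proof.
move=> c0; rewrite /zero_divisor size_scale // size_prod_XsubC /=.
congr (_ + _); case: closed_field_poly_normal => r /= Er.
apply/perm_big/prod_XsubC_eq; apply: (scalerI c0); rewrite Er.
by rewrite lead_coefZ lead_coef_prod_XsubC mulr1.
Qed.

(** The point at infinity is counted by the defect of the degree, so this holds
    for all formal degrees, even below the actual ones. *)
Lemma zero_divisorM a b f g : f != 0 -> g != 0 ->
  zero_divisor (a + b) (f * g) = zero_divisor a f + zero_divisor b g.
Proof.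
have [[s fE] [t gE]] := (closed_field_poly_normal f, closed_field_poly_normal g).
rewrite -!lead_coef_eq0; set c := lead_coef f in fE *; set e := lead_coef g in gE *.
move=> c0 e0; rewrite fE gE -scalerAl -scalerAr scalerA -big_cat /=.
rewrite !zero_divisorE ?mulf_neq0 // big_cat size_cat /= addrACA freegUD.
by congr (_ + << _ *g _ >>); rewrite !PoszD; ring.
Qed.

(** For [a = 0] the form is a multiple of y, which vanishes at infinity. *)
Lemma zero_divisor_linear (a b : F) : ~~ ((a == 0) && (b == 0)) ->
  zero_divisor 1 (a *: 'X - b%:P) = << if a == 0 then None else Some (b / a) >>.
Proof.
have [->|a0 _] := eqVneq a 0 => /= [b0|].
  have -> : 0 *: 'X - b%:P = (- b) *: [::]^P.
    by rewrite big_nil scale0r sub0r -mul_polyC mulr1 polyCN.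
  by rewrite zero_divisorE ?oppr_eq0 // big_nil add0r subr0.
have -> : a *: 'X - b%:P = a *: [:: b / a]^P.
  by rewrite big_seq1 scalerBr -!mul_polyC -polyCM mulrCA divff // mulr1.
by rewrite zero_divisorE // big_seq1 subrr freegU0 addr0.
Qed.

Lemma zero_divisorZ n c f : c != 0 -> f != 0 ->
  zero_divisor n (c *: f) = zero_divisor n f.
Proof.
have [s fE] := closed_field_poly_normal f; rewrite -lead_coef_eq0.
move: (lead_coef f) fE => e -> c0 e0.
by rewrite scalerA !zero_divisorE ?mulf_neq0.
Qed.

Variables al be ga de : F.
Hypothesis det_neq0 : al * de - be * ga != 0.
Local Notation act := (form_act al be ga de).
Local Notation mob := (mobius al be ga de).

Lemma form_act_XsubC x :
  act 1 ('X - x%:P) = (ga * x + de) *: 'X - (al * x + be)%:P.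
Proof.
rewrite /form_act !big_ord_recl big_ord0 !coefE /= !(expr0, expr1).
by rewrite -!mul_polyC !(polyCD, polyCM, polyCN); ring.
Qed.

Lemma form_act_one n : act n 1 = (al%:P - ga *: 'X) ^+ n.
Proof.
rewrite /form_act big_ord_recl big1 => [|i _]; last by rewrite coef1 scale0r.
by rewrite coef1 scale1r expr0 mul1r subn0 addr0.
Qed.

Lemma zero_divisor_act_XsubC x :
  zero_divisor 1 (act 1 ('X - x%:P)) = << mob (Some x) >>.
Proof.
rewrite form_act_XsubC zero_divisor_linear //.
apply: contra_neqN det_neq0 => /andP[/eqP gx /eqP ax].
have -> : al * de - be * ga = al * (ga * x + de) - ga * (al * x + be) by ring.
by rewrite gx ax !mulr0 subr0.
Qed.

Lemma zero_divisor_act_one n : zero_divisor n (act n 1) = << n%:Z *g mob None >>.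
Proof.
rewrite form_act_one; elim: n => [|n IHn].
  have -> : (al%:P - ga *: 'X) ^+ 0 = 1 *: [::]^P by rewrite big_nil scale1r.
  by rewrite zero_divisorE ?oner_eq0 // big_nil add0r subrr !freegU0.
have l0 := lin2_neq0 det_neq0.
rewrite exprS -add1n zero_divisorM ?expf_neq0 // IHn PoszD -freegUD; congr (_ + _).
have -> : al%:P - ga *: 'X = (- ga) *: 'X - (- al)%:P.
  by rewrite polyCN opprK scaleNr addrC.
rewrite zero_divisor_linear !oppr_eq0; last first.
  apply: contra_neqN det_neq0 => /andP[/eqP-> /eqP->].
  by rewrite mul0r mulr0 subr0.
by rewrite /= invrN mulrNN.
Qed.

Lemma form_act_neq0 n f : (size f <= n.+1)%N -> f != 0 -> act n f != 0.
Proof. by move=> szf; apply: contra_neq; apply: form_act_inj. Qed.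

Lemma zero_divisor_act_prod s :
  zero_divisor (size s) (act (size s) s^P) = \sum_(x <- s) << mob (Some x) >>.
Proof.
elim: s => [|x s IHs]; first by rewrite !big_nil zero_divisor_act_one freegU0.
have sP0 : s^P != 0 by rewrite -size_poly_eq0 size_prod_XsubC.
rewrite !big_cons /= -add1n form_actM ?size_XsubC ?size_prod_XsubC //.
rewrite zero_divisorM ?zero_divisor_act_XsubC ?IHs //.
  by rewrite form_act_neq0 ?size_XsubC ?polyXsubC_eq0.
by rewrite form_act_neq0 ?size_prod_XsubC.
Qed.

(** In degree [n], a product of [r] factors ['X - x%:P] is this product
    times y^(n - r), that is, times [1] taken as a form of degree [n - r]. *)
Lemma zero_divisor_form_act n c f : c != 0 -> f != 0 -> (size f <= n.+1)%N ->
  zero_divisor n (c *: act n f) = push_divisor mob (zero_divisor n f).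
Proof.
move=> c0 f0 szf; rewrite zero_divisorZ ?form_act_neq0 //.
move: f0 szf; have [s fE] := closed_field_poly_normal f; rewrite -lead_coef_eq0.
move: (lead_coef f) fE => e -> e0; rewrite size_scale // size_prod_XsubC ltnS => le_sn.
have sP0 : s^P != 0 by rewrite -size_poly_eq0 size_prod_XsubC.
have pushE : push_divisor mob (zero_divisor n (e *: s^P)) =
    \sum_(x <- s) << mob (Some x) >> + << (n - size s)%N%:Z *g mob None >>.
  rewrite zero_divisorE // raddfD raddf_sum /= push_divisorU -subzn //.
  by congr (_ + _); apply: eq_bigr => x _; rewrite push_divisorU.
rewrite pushE linearZ /= zero_divisorZ ?form_act_neq0 ?size_prod_XsubC //.
rewrite -[s^P]mulr1 -{1 2}(subnKC le_sn) form_actM ?size_prod_XsubC ?size_poly1 //.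
rewrite zero_divisorM ?form_act_neq0 ?size_prod_XsubC ?size_poly1 ?oner_eq0 //.
by rewrite zero_divisor_act_prod zero_divisor_act_one.
Qed.

End DivisorsPush.
(** * Commutation with the Mobius group *)

Theorem theorem2 (R : realType) (d k : nat)
  (hd : (1 <= d)%N) (hk : k = 0%N -> (3 <= d)%N)
  (w : {poly R[i]} * {poly R[i]}) (hw : RatStar d k w)
  (al be ga de : R[i]) (hg : al * de - be * ga != 0)
  (hgw : RatStar d k (rat_act al be ga de d k w)) :
  let N := (2 * d + 4 * k - 4)%N in
  let ID_w := isodynamic d w in
  let ID_gw := isodynamic d (rat_act al be ga de d k w) in
  [/\ ID_w != 0,
      (size ID_w <= N.+1)%N,
      (exists2 c : R[i], c != 0 & ID_gw = c *: form_act al be ga de N ID_w)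
    & zero_divisor N ID_gw =
      push_divisor (mobius al be ga de) (zero_divisor N ID_w)].
Proof.
move=> N ID_w ID_gw; have char0 : has_char0 R[i] by exact: pchar_num.
have [m dkm] : exists m, (d + k + k)%N = m.+2.
  exists (d + k + k - 2)%N; rewrite -addn2 subnK //.
  by case: (posnP k) => [k0|]; [have := hk k0|]; lia.
have NE : N = (m + m)%N by rewrite /N; lia.
have [[szp szq _ _] [szgp szgq _ _]] := (hw, hgw).
have [c1 c1_neq0 ID_wE] := isodynamic_form char0 hd dkm szp szq.
have [c2 c2_neq0 ID_gwE] := isodynamic_form char0 hd dkm szgp szgq.
have [c3 c3_neq0 actE] := form_discr_polar_act char0 hd dkm hg szp szq.
have ID_w_neq0 : ID_w != 0.
  by rewrite /ID_w ID_wE scaler_eq0 negb_or c1_neq0 (form_discr_polar_neq0 char0 hd dkm hw).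
have szID_w : (size ID_w <= N.+1)%N.
  by rewrite /ID_w ID_wE size_scale // NE (size_form_discr_polar char0 hd dkm szp szq).
have [c c_neq0 covE] : exists2 c : R[i], c != 0 &
    ID_gw = c *: form_act al be ga de N ID_w.
  exists (c2 * c3 / c1); first by rewrite !mulf_neq0 ?invr_eq0.
  by rewrite /ID_gw /ID_w ID_wE [in RHS]linearZ /= ID_gwE actE NE !scalerA divfK.
split=> //; first by exists c.
by rewrite covE zero_divisor_form_act.
Qed.
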